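(* (i) For fixed value of $\lambda\in\mathbb{R}\setminus[0,1]$, the four common generating lines of the one-sheeted hyperboloid $\mathcal{Q}_\lambda$ and the extended oloid $\mathcal{O}$ are $$\mathcal{G}_1(\lambda)=\{(\tilde\omega_1(m,\lambda),\tilde\omega_2(m,\lambda),\tilde\omega_3(m,\lambda)): m\in\mathbb{R}\},$$ $$\mathcal{G}_2(\lambda)=\{(-\tilde\omega_1(m,\lambda),\tilde\omega_2(m,\lambda),\tilde\omega_3(m,\lambda)): m\in\mathbb{R}\},$$ $$\mathcal{G}_3(\lambda)=\{(-\tilde\omega_1(m,\lambda),\tilde\omega_2(m,\lambda),-\tilde\omega_3(m,\lambda)): m\in\mathbb{R}\},$$ $$\mathcal{G}_4(\lambda)=\{(\tilde\omega_1(m,\lambda),\tilde\omega_2(m,\lambda),-\tilde\omega_3(m,\lambda)): m\in\mathbb{R}\},$$ with $$\tilde\omega_1(m,\lambda)=(1-m)\,\frac{\sqrt{(\lambda-1)(2-\lambda+2\rho(\lambda))}}{-|\lambda|},$$ $$\tilde\omega_2(m,\lambda)=(1-m)\,\frac{\lambda-2-2\rho(\lambda)}{2\lambda}+m\,\frac{2\lambda-1-\rho(\lambda)}{2(1+\rho(\lambda))},$$ $$\tilde\omega_3(m,\lambda)=m\,\frac{\operatorname{sgn}(\lambda)\sqrt{\lambda(2-\lambda+2\rho(\lambda))}}{1+\rho(\lambda)},$$ where $\rho(\lambda)=\operatorname{sgn}(\lambda)\sqrt{1-\lambda+\lambda^2}$. (ii) $\mathcal{G}_1(\lambda),\mathcal{G}_2(\lambda),\mathcal{G}_3(\lambda),\mathcal{G}_4(\lambda)$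 are the tangents to the edge of regression $\mathcal{R}$ of $\mathcal{O}$, and to the touching curve $\mathcal{C}_\lambda$ between $\mathcal{O}$ and $\mathcal{Q}_\lambda$, in the respective points $$P_1(\lambda)=(r_1(\lambda),r_2(\lambda),r_3(\lambda)),\quad P_2(\lambda)=(-r_1(\lambda),r_2(\lambda),r_3(\lambda)),$$ $$P_3(\lambda)=(-r_1(\lambda),r_2(\lambda),-r_3(\lambda)),\quad P_4(\lambda)=(r_1(\lambda),r_2(\lambda),-r_3(\lambda)),$$ where $$r_1(\lambda)=\frac{\sqrt{(\lambda-1)^3[2-\lambda+2\rho(\lambda)]}}{\lambda[2-\lambda+\rho(\lambda)]},\quad r_2(\lambda)=\frac{\lambda^2+2\lambda-2+(\lambda-2)\rho(\lambda)}{2\lambda[2-\lambda+\rho(\lambda)]},\quad r_3(\lambda)=\frac{\operatorname{sgn}(\lambda)\sqrt{\lambda[2-\lambda+2\rho(\lambda)]}}{2-\lambda+\rho(\lambda)}.$$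
   Context: The extended oloid $\mathcal{O}$ is the developable surface containing the surface of the convex hull of the circles $k_A: x^2+(y+\frac12)^2=1, z=0$ and $k_B:(y-\frac12)^2+z^2=1, x=0$; it is the union of the generating lines $x=\omega_1(m,t)$, $y=\omega_2(m,t)$, $z=\pm\omega_3(m,t)$, $m\in\mathbb{R}$, for $t\in[-\frac{2\pi}3,\frac{2\pi}3]$, where $$\omega_1=(1-m)\sin t,\quad \omega_2=(1-m)\left(-\tfrac12-\cos t\right)+m\left(\tfrac12-\tfrac{\cos t}{1+\cos t}\right),\quad \omega_3=\frac{m\sqrt{1+2\cos t}}{1+\cos t}.$$ Its inscribed quadrics are $\mathcal{Q}_\lambda:\ \frac{x^2}{1-\lambda}+\frac{(y-\lambda+1/2)^2}{1-\lambda+\lambda^2}+\frac{z^2}{\lambda}=1$; for $\lambda\in\mathbb{R}\setminus[0,1]$ this is a hyperboloid of one sheet. A common generating line of $\mathcal{Q}_\lambda$ and $\mathcal{O}$ is a generating line of $\mathcal{O}$ contained in $\mathcal{Q}_\lambda$. The touching curve $\mathcal{C}_\lambda$, along which $\mathcal{O}$ and $\mathcal{Q}_\lambda$ touch, is parametrized by $(\kappa_1,\kappa_2,\kappa_3)(\lambda,t)$ for $t\in[-\frac{2\pi}3,\frac{2\pi}3]$ and $(\kappa_1,\kappa_2,-\kappa_3)(\lambda,\frac{4\pi}3-t)$ for $t\in(\frac{2\pi}3,2\pi]$ (poles excluded), where $$\kappa_1(\lambda,t)=\frac{(1-\lambda)\sin t}{1+\lambda\cos t},\quad \kappa_2(\lambda,t)=\frac{2\lambda-1+(\lambda-2)\cos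 t}{2(1+\lambda\cos t)},\quad \kappa_3(\lambda,t)=\frac{\lambda\sqrt{1+2\cos t}}{1+\lambda\cos t}.$$ The edge of regression $\mathcal{R}$ of $\mathcal{O}$ (the curve to which all generating lines of $\mathcal{O}$ are tangent) is given by $x=\frac{\sin t-\tan t}3$, $y=\frac{2+3\cos t-3\cos^2t-2\cos^3t}{6(1+\cos t)\cos t}$, $z=\pm\frac{(1+2\cos t)^{3/2}}{3(1+\cos t)\cos t}$, $t\in[-\frac{2\pi}3,\frac{2\pi}3]$, $t\neq\pm\frac\pi2$. *)

(* Defs.v *)
From Stdlib Require Import Reals Ensembles.
From Coquelicot Require Import Coquelicot.
Open Scope R_scope.

Notation R3 := (R * R * R)%type.

(** [L] is the tangent at [P] of the curve [gamma], whose parameter ranges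
    over [D]; the parameter value of [P] has to be interior and regular. *)
Definition tangent_at (D : R -> Prop) (gamma : R -> R3) (P : R3)
    (L : Ensemble R3) : Prop :=
  exists (t0 : R) (v : R3),
    locally t0 D /\ gamma t0 = P /\ is_derive gamma t0 v /\ v <> zero /\
    Same_set R3 L (fun p => exists s : R, p = plus P (scal s v)).

Definition oloid_param (t : R) : Prop := - (2 * PI / 3) <= t <= 2 * PI / 3.

Definition is_sign (eps : R) : Prop := eps = 1 \/ eps = -1.

Definition omega1 (m t : R) : R := (1 - m) * sin t.
Definition omega2 (m t : R) : R :=
  (1 - m) * (- (1 / 2) - cos t) + m * (1 / 2 - cos t / (1 + cos t)).
Definition omega3 (m t : R) : R := m * sqrt (1 + 2 * cos t) / (1 + cos t).

Definition oloid_line (eps t : R) : Ensemble R3 :=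
  fun p => exists m : R, p = (omega1 m t, omega2 m t, eps * omega3 m t).

Definition extended_oloid : Ensemble R3 :=
  fun p => exists eps t : R, is_sign eps /\ oloid_param t /\ oloid_line eps t p.

(** The generating lines of [extended_oloid] are the lines of the family
    sweeping it out. *)
Definition generating_line (L : Ensemble R3) : Prop :=
  exists eps t : R,
    is_sign eps /\ oloid_param t /\ Same_set R3 L (oloid_line eps t).

Definition quadric (lambda : R) : Ensemble R3 :=
  fun '(x, y, z) =>
    x ^ 2 / (1 - lambda) + (y - lambda + 1 / 2) ^ 2 / (1 - lambda + lambda ^ 2)
      + z ^ 2 / lambda = 1.

Definition common_generating_line (lambda : R) (L : Ensemble R3) : Prop :=
  generating_line L /\ Included R3 L (quadric lambda).

Definition kappa1 (lambda t : R) : R :=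
  (1 - lambda) * sin t / (1 + lambda * cos t).
Definition kappa2 (lambda t : R) : R :=
  (2 * lambda - 1 + (lambda - 2) * cos t) / (2 * (1 + lambda * cos t)).
Definition kappa3 (lambda t : R) : R :=
  lambda * sqrt (1 + 2 * cos t) / (1 + lambda * cos t).

Definition touching_curve (lambda t : R) : R3 :=
  if Rle_dec t (2 * PI / 3)
  then (kappa1 lambda t, kappa2 lambda t, kappa3 lambda t)
  else let u := 4 * PI / 3 - t in
       (kappa1 lambda u, kappa2 lambda u, - kappa3 lambda u).

(** Poles are excluded on either piece. *)
Definition touching_param (lambda t : R) : Prop :=
  (- (2 * PI / 3) <= t <= 2 * PI / 3 /\ 1 + lambda * cos t <> 0) \/
  (2 * PI / 3 < t <= 2 * PI /\ 1 + lambda * cos (4 * PI / 3 - t) <> 0).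

Definition tangent_to_touching_curve (lambda : R) (L : Ensemble R3) (P : R3)
    : Prop :=
  tangent_at (touching_param lambda) (touching_curve lambda) P L.

(** The power 3/2 is written as the cube of [sqrt], because
    [Rpower 0 (3 / 2) = 1], and [1 + 2 * cos t] vanishes at the end points. *)
Definition edge_curve (eps t : R) : R3 :=
  ((sin t - tan t) / 3,
   (2 + 3 * cos t - 3 * cos t ^ 2 - 2 * cos t ^ 3)
     / (6 * (1 + cos t) * cos t),
   eps * (sqrt (1 + 2 * cos t) ^ 3 / (3 * (1 + cos t) * cos t))).

Definition edge_param (t : R) : Prop :=
  oloid_param t /\ t <> PI / 2 /\ t <> - (PI / 2).

(** The edge of regression consists of the two branches [eps = 1] and
    [eps = -1]. *)
Definition tangent_to_edge (L : Ensemble R3) (P : R3) : Prop :=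
  exists eps : R, is_sign eps /\ tangent_at edge_param (edge_curve eps) P L.

Definition rho (lambda : R) : R :=
  sign lambda * sqrt (1 - lambda + lambda ^ 2).

Definition omegat1 (m lambda : R) : R :=
  (1 - m) * (sqrt ((lambda - 1) * (2 - lambda + 2 * rho lambda))
             / (- Rabs lambda)).
Definition omegat2 (m lambda : R) : R :=
  (1 - m) * ((lambda - 2 - 2 * rho lambda) / (2 * lambda))
  + m * ((2 * lambda - 1 - rho lambda) / (2 * (1 + rho lambda))).
Definition omegat3 (m lambda : R) : R :=
  m * (sign lambda * sqrt (lambda * (2 - lambda + 2 * rho lambda))
       / (1 + rho lambda)).

Definition G1 (lambda : R) : Ensemble R3 := fun p =>
  exists m : R, p = (omegat1 m lambda, omegat2 m lambda, omegat3 m lambda).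
Definition G2 (lambda : R) : Ensemble R3 := fun p =>
  exists m : R, p = (- omegat1 m lambda, omegat2 m lambda, omegat3 m lambda).
Definition G3 (lambda : R) : Ensemble R3 := fun p =>
  exists m : R, p = (- omegat1 m lambda, omegat2 m lambda, - omegat3 m lambda).
Definition G4 (lambda : R) : Ensemble R3 := fun p =>
  exists m : R, p = (omegat1 m lambda, omegat2 m lambda, - omegat3 m lambda).

Definition r1 (lambda : R) : R :=
  sqrt ((lambda - 1) ^ 3 * (2 - lambda + 2 * rho lambda))
  / (lambda * (2 - lambda + rho lambda)).
Definition r2 (lambda : R) : R :=
  (lambda ^ 2 + 2 * lambda - 2 + (lambda - 2) * rho lambda)
  / (2 * lambda * (2 - lambda + rho lambda)).
Definition r3 (lambda : R) : R :=
  sign lambda * sqrt (lambda * (2 - lambda + 2 * rho lambda))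
  / (2 - lambda + rho lambda).

Definition P1 (lambda : R) : R3 := (r1 lambda, r2 lambda, r3 lambda).
Definition P2 (lambda : R) : R3 := (- r1 lambda, r2 lambda, r3 lambda).
Definition P3 (lambda : R) : R3 := (- r1 lambda, r2 lambda, - r3 lambda).
Definition P4 (lambda : R) : R3 := (r1 lambda, r2 lambda, - r3 lambda).

(* Main.v *)
Require Import Defs.
From Stdlib Require Import Reals Ensembles Lra.
From Coquelicot Require Import Coquelicot.
Open Scope R_scope.

(** Write [c] for [cos t] and [s] for [sin t].

    _Which generators lie in the quadric._  Restricted to the generator of
    parameter [t], the equation of the quadric is quadratic in [m].  As the
    quadric touches the oloid, this quadratic is a perfect square: up to a
    factor that does not involve [m], it is the square of
    [1 - m / touching_ratio lambda t], where [touching_ratio lambda t] is the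
    value of [m] at the point of contact ([quadric_along_oloid_line]).  So the
    generator lies in the quadric exactly when that factor vanishes, that is,
    when [lambda * (c * (c + 2)) = 1 + 2 * c] ([contact_equation]).  For
    [lambda] outside [[0, 1]] this quadratic equation has exactly one root
    [c >= -1/2], namely [c = (1 - lambda + rho) / lambda], and it lies in
    [(-1/2, 1)].  It determines [t] up to sign; the two signs of [t] and the two
    signs of [z] give four generators.  At the root, [rho = lambda (1 + c) - 1],
    which turns every radicand of the closed formulas into a square times
    [1] or [1 + 2 * c].

    _Why they are tangents._  Since the surface is developable, the velocity
    of the ruled parametrization in the direction of [t] is parallel to the
    generator at one point of it, where [m = (1 + 2 * c) / (3 * c)]; there it
    is [(1 - c) / (3 * s)] times the direction of the generator.  Any curve
    [t |-> (m t, t)] on the surface passing through that point is therefore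
    tangent to the generator, provided that
    [m' t + (1 - c) / (3 * s)] does not vanish ([ruled_curve_tangent]).  The
    edge of regression is the curve with [m = edge_ratio], and the touching
    curve the one with [m = touching_ratio lambda]; the two ratios agree
    precisely under the contact equation, so that both curves pass through
    the critical point of each of the four generators, with nonzero speed. *)

(** * Lines, tangents and derivatives of space curves *)

Lemma Same_set_sym (T : Type) (A B : Ensemble T) : Same_set T A B -> Same_set T B A.
Proof. intros [H1 H2]; split; assumption. Qed.

Lemma Same_set_trans (T : Type) (A B C : Ensemble T) :
  Same_set T A B -> Same_set T B C -> Same_set T A C.
Proof.
  intros [H1 H2] [H3 H4]; split; intros x Hx; [apply H3, H1 | apply H2, H4]; exact Hx.
Qed.

Lemma Same_set_pointwise (f g : R -> R3) :
  (forall m, f m = g m) ->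
  Same_set R3 (fun p => exists m, p = f m) (fun p => exists m, p = g m).
Proof.
  intros H; split; intros p [m ->]; exists m; [|symmetry]; apply H.
Qed.

Lemma tangent_at_Same_set D gamma P L L' :
  Same_set R3 L L' -> tangent_at D gamma P L -> tangent_at D gamma P L'.
Proof.
  intros HL (t & v & HD & HP & Hd & Hv & HS).
  exists t, v; do 4 (split; [assumption|]).
  exact (Same_set_trans _ _ _ _ (Same_set_sym _ _ _ HL) HS).
Qed.

Lemma tangent_to_edge_Same_set P L L' :
  Same_set R3 L L' -> tangent_to_edge L P -> tangent_to_edge L' P.
Proof.
  intros HL (eps & He & H); exists eps; split; [exact He|].
  exact (tangent_at_Same_set _ _ _ _ _ HL H).
Qed.

Lemma is_derive_pair {V W : NormedModule R_AbsRing} (f : R -> V) (g : R -> W)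
    (t : R) (df : V) (dg : W) :
  is_derive f t df -> is_derive g t dg ->
  is_derive (fun u => (f u, g u)) t (df, dg).
Proof.
  intros Hf Hg; unfold is_derive.
  apply (filterdiff_ext_lin _
           (fun y : R => (scal y df, scal y dg) : prod_NormedModule _ V W)).
  2: intros y; reflexivity.
  apply (filterdiff_comp_2 f g (fun a b => (a, b) : prod_NormedModule _ V W)
           (fun y : R => scal y df) (fun y : R => scal y dg) (fun a b => (a, b)) Hf Hg).
  apply filterdiff_linear, is_linear_prod; [apply is_linear_fst | apply is_linear_snd].
Qed.

Lemma locally_neq_0 (f : R -> R) (t : R) :
  continuous f t -> f t <> 0 -> locally t (fun u => f u <> 0).
Proof. intros Hc H; apply (Hc (fun y => y <> 0)), (open_neq 0 (f t) H). Qed.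

(** * The parameter interval of the oloid *)

Lemma cos_ge_on_oloid_param t : oloid_param t -> 0 <= 1 + 2 * cos t.
Proof.
  intros [H1 H2]. pose proof PI_RGT_0.
  assert (Hc : cos t = cos (Rabs t))
    by (unfold Rabs; destruct Rcase_abs; rewrite ?cos_neg; reflexivity).
  assert (Ha : 0 <= Rabs t <= 2 * (PI / 3)).
  { split; [apply Rabs_pos | apply Rabs_le; lra]. }
  assert (cos (2 * (PI / 3)) <= cos (Rabs t)) by (apply cos_decr_1; lra).
  rewrite cos_2PI3 in *; lra.
Qed.

Lemma oloid_param_interior t :
  oloid_param t -> 0 < 1 + 2 * cos t -> - (2 * PI / 3) < t < 2 * PI / 3.
Proof.
  intros [H1 H2] Hc.
  assert (He : cos (2 * PI / 3) = - 1 / 2)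
    by (rewrite <- cos_2PI3; f_equal; field).
  split.
  - destruct H1 as [|H1]; [assumption|]. rewrite <- H1, cos_neg in Hc; lra.
  - destruct H2 as [|H2]; [assumption|]. rewrite H2 in Hc; lra.
Qed.

(** The negative sign of the parameter is the one that belongs to [G1], whose
    points with [m < 1] have negative abscissa. *)
Lemma oloid_param_opp_acos c :
  - 1 / 2 < c < 1 -> oloid_param (- acos c) /\ cos (- acos c) = c /\ sin (- acos c) < 0.
Proof.
  intros Hc. pose proof PI_RGT_0. destruct (acos_bound c).
  repeat split.
  - assert (acos c <= 2 * (PI / 3)); [|lra].
    apply Rnot_lt_le; intros Hlt.
    apply cos_decreasing_1 in Hlt; try lra.
    rewrite cos_acos, cos_2PI3 in Hlt; lra.
  - lra.
  - rewrite cos_neg; apply cos_acos; lra.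
  - rewrite sin_neg, sin_acos by lra.
    assert (0 < sqrt (1 - c²)); [apply sqrt_lt_R0; unfold Rsqr; nra | lra].
Qed.

(** * Curves on the ruled surface *)

Definition ruled (eps m t : R) : R3 := (omega1 m t, omega2 m t, eps * omega3 m t).

(** The derivative of [ruled eps m t] in [m]. *)
Definition ruling_direction (eps t : R) : R3 :=
  (- sin t, cos t + / (1 + cos t), eps * (sqrt (1 + 2 * cos t) / (1 + cos t))).

Lemma scal_R3 (k x y z : R) : scal k ((x, y, z) : R3) = (k * x, k * y, k * z).
Proof. reflexivity. Qed.

Lemma plus_scal_R3 (a b c k x y z : R) :
  plus ((a, b, c) : R3) (scal k ((x, y, z) : R3)) = (a + k * x, b + k * y, c + k * z).
Proof. reflexivity. Qed.

Lemma ruled_affine eps m m0 t :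
  1 + cos t <> 0 ->
  ruled eps m t = plus (ruled eps m0 t) (scal (m - m0) (ruling_direction eps t)).
Proof.
  intros H. etransitivity; [|symmetry; apply plus_scal_R3].
  unfold ruled, omega1, omega2, omega3.
  f_equal; [f_equal|];
    match goal with |- @eq _ ?a ?b => change (@eq R a b) end; field; assumption.
Qed.

(** The value of [m] at which the generator is tangent to the edge of
    regression.  It makes both [t]- and [m]-derivatives of [ruled] parallel:
    the abscissa requires [(1 - m) * cos t = - a * sin t], the other two
    coordinates then force [a = (1 - cos t) / (3 * sin t)]. *)
Definition edge_ratio (t : R) : R := (1 + 2 * cos t) / (3 * cos t).

(** Both coordinates of the parameter contribute a multiple of the ruling
    direction: [mu] by its own derivative, and [tau], because the point lies
    on the edge of regression, by its derivative times
    [(1 - cos t) / (3 * sin t)].  The inner parameter [tau] is needed for the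
    second piece of the touching curve, which is traversed backwards. *)
Lemma ruled_curve_derive eps (mu tau : R -> R) (u t dmu k : R) :
  tau u = t -> is_derive mu u dmu -> is_derive tau u k ->
  0 < 1 + 2 * cos t -> cos t <> 0 -> sin t <> 0 -> mu u = edge_ratio t ->
  is_derive (fun w => ruled eps (mu w) (tau w)) u
    (scal (dmu + k * ((1 - cos t) / (3 * sin t))) (ruling_direction eps t)).
Proof.
  intros Ht Hmu Htau Hq Hc Hs Hm.
  assert (Emu : ex_derive mu u) by (exists dmu; exact Hmu).
  assert (Etau : ex_derive tau u) by (exists k; exact Htau).
  assert (H1 : 1 + cos t <> 0) by lra.
  assert (Hsc : sin t * sin t = 1 - cos t * cos t)
    by (pose proof (sin2_cos2 t) as Hp; unfold Rsqr in Hp; lra).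
  assert (Hqs : sqrt (1 + 2 * cos t) * sqrt (1 + 2 * cos t) = 1 + 2 * cos t)
    by (apply sqrt_sqrt; lra).
  assert (Hq0 : sqrt (1 + 2 * cos t) <> 0) by (apply Rgt_not_eq, sqrt_lt_R0, Hq).
  assert (Dmu : Derive (fun x => mu x) u = dmu) by (apply is_derive_unique, Hmu).
  assert (Dtau : Derive (fun x => tau x) u = k) by (apply is_derive_unique, Htau).
  unfold ruled, ruling_direction, omega1, omega2, omega3.
  rewrite scal_R3.
  apply (is_derive_pair (fun w => (_, _)) _ u (_, _) _);
    [apply is_derive_pair|]; auto_derive; rewrite ?Ht; repeat split; try assumption; try lra;
    rewrite Dmu, Dtau, Hm; unfold edge_ratio; clear - Hc Hs Hsc Hqs Hq0 H1;
    revert Hc Hs Hsc Hqs Hq0 H1; generalize (cos t) (sin t) (sqrt (1 + 2 * cos t));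
    intros c s q Hc Hs Hsc Hqs Hq0 H1.
  - field_simplify_eq; [|tauto]. nra.
  - field_simplify_eq; [|tauto].
    replace (s ^ 2) with (1 - c * c) by (rewrite <- Hsc; ring); ring.
  - field_simplify_eq; [|tauto].
    replace (s ^ 2) with (1 - c * c) by (rewrite <- Hsc; ring).
    replace (q ^ 2) with (1 + 2 * c) by (rewrite <- Hqs; ring); ring.
Qed.

Lemma ruled_curve_tangent (D : R -> Prop) (gamma : R -> R3) eps (mu tau : R -> R)
    (u t dmu k : R) :
  tau u = t -> is_derive mu u dmu -> is_derive tau u k ->
  0 < 1 + 2 * cos t -> cos t <> 0 -> sin t <> 0 -> mu u = edge_ratio t ->
  dmu + k * ((1 - cos t) / (3 * sin t)) <> 0 ->
  locally u D -> locally u (fun w => gamma w = ruled eps (mu w) (tau w)) ->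
  tangent_at D gamma (ruled eps (edge_ratio t) t) (oloid_line eps t).
Proof.
  intros Ht Hmu Htau Hq Hc Hs Hm Hk HD Hg.
  set (v := dmu + k * ((1 - cos t) / (3 * sin t))) in *.
  exists u, (scal v (ruling_direction eps t)).
  split; [exact HD|]. split; [|split; [|split]].
  - rewrite (locally_singleton _ _ Hg), Ht, Hm; reflexivity.
  - apply (is_derive_ext_loc (fun w => ruled eps (mu w) (tau w))).
    { apply filter_imp with (2 := Hg); intros w Hw; symmetry; exact Hw. }
    apply ruled_curve_derive; assumption.
  - intros H0. apply (f_equal (fun p : R3 => fst (fst p))) in H0.
    change (v * - sin t = 0) in H0.
    apply Rmult_integral in H0; lra.
  - split; intros p [m ->].
    + exists ((m - edge_ratio t) / v).
      change (omega1 m t, omega2 m t, eps * omega3 m t) with (ruled eps m t).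
      rewrite (ruled_affine eps m (edge_ratio t)) by lra.
      rewrite scal_assoc; do 2 f_equal.
      change (m - edge_ratio t = (m - edge_ratio t) / v * v); field; exact Hk.
    + exists (edge_ratio t + m * v).
      change (omega1 ?a t, omega2 ?a t, eps * omega3 ?a t) with (ruled eps a t).
      symmetry; etransitivity; [apply (ruled_affine eps _ (edge_ratio t)); lra|].
      rewrite scal_assoc; do 2 f_equal.
      change (edge_ratio t + m * v - edge_ratio t = m * v); ring.
Qed.

(** * The edge of regression and the touching curve *)

Lemma edge_curve_ruled eps t :
  0 <= 1 + 2 * cos t -> cos t <> 0 -> edge_curve eps t = ruled eps (edge_ratio t) t.
Proof.
  intros Hq Hc. assert (H1 : 1 + cos t <> 0) by lra.
  unfold edge_curve, ruled, omega1, omega2, omega3, edge_ratio, tan.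
  replace (sqrt (1 + 2 * cos t) ^ 3) with ((1 + 2 * cos t) * sqrt (1 + 2 * cos t)).
  2: { rewrite <- (sqrt_sqrt (1 + 2 * cos t)) at 1 by exact Hq; ring. }
  f_equal; [f_equal|]; field; tauto.
Qed.

Definition touching_ratio (lambda t : R) : R :=
  lambda * (1 + cos t) / (1 + lambda * cos t).

Lemma kappa_ruled lambda eps t :
  1 + cos t <> 0 -> 1 + lambda * cos t <> 0 ->
  (kappa1 lambda t, kappa2 lambda t, eps * kappa3 lambda t)
  = ruled eps (touching_ratio lambda t) t.
Proof.
  intros H1 Hl.
  unfold ruled, omega1, omega2, omega3, kappa1, kappa2, kappa3, touching_ratio.
  f_equal; [f_equal|]; field; tauto.
Qed.

(** The relation between [lambda] and [t] under which the generator of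
    parameter [t] lies in the quadric, and under which it is tangent to the
    touching curve. *)
Definition contact_equation (lambda t : R) : Prop :=
  lambda * (cos t * (cos t + 2)) = 1 + 2 * cos t.

(** Under the contact equation,
    [(1 + lambda * cos t) * (cos t + 2) = 3 * (1 + cos t)], so that the point
    of contact is not a pole of the touching curve. *)
Lemma contact_denominator lambda t :
  contact_equation lambda t -> 0 < 1 + 2 * cos t -> 1 + lambda * cos t <> 0.
Proof. unfold contact_equation; intros He Hq H0; nra. Qed.

Lemma touching_ratio_contact lambda t :
  contact_equation lambda t -> 0 < 1 + 2 * cos t -> cos t <> 0 ->
  touching_ratio lambda t = edge_ratio t.
Proof.
  intros He Hq Hc. pose proof (contact_denominator _ _ He Hq).
  unfold touching_ratio, edge_ratio, contact_equation in *.
  field_simplify_eq; [|tauto]. nra.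
Qed.

Lemma edge_ratio_derive t :
  cos t <> 0 -> is_derive edge_ratio t (sin t / (3 * cos t ^ 2)).
Proof. intros Hc; unfold edge_ratio; auto_derive; [lra|field; exact Hc]. Qed.

Lemma touching_ratio_derive lambda t :
  1 + lambda * cos t <> 0 ->
  is_derive (touching_ratio lambda) t
    (lambda * (lambda - 1) * sin t / (1 + lambda * cos t) ^ 2).
Proof. intros H; unfold touching_ratio; auto_derive; [lra|field; exact H]. Qed.

(** Up to a nonzero factor the speed is
    [sin t ^ 2 + (1 - cos t) * cos t ^ 2 = 1 - cos t ^ 3]. *)
Lemma edge_speed_neq_0 t :
  cos t <> 0 -> sin t <> 0 ->
  sin t / (3 * cos t ^ 2) + 1 * ((1 - cos t) / (3 * sin t)) <> 0.
Proof.
  intros Hc Hs H0. pose proof (sin2_cos2 t) as Hp; unfold Rsqr in Hp.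
  assert (H : sin t ^ 2 + (1 - cos t) * cos t ^ 2 = 0).
  { replace 0 with (3 * cos t ^ 2 * sin t * 0) by ring; rewrite <- H0; field; tauto. }
  assert (0 < sin t ^ 2) by (apply pow2_gt_0; exact Hs).
  pose proof (COS_bound t). assert (0 <= cos t ^ 2) by (apply pow2_ge_0). nra.
Qed.

(** Outside [[0, 1]], [lambda * (lambda - 1)] is positive, so that the two
    terms of the speed have the same sign, that of [sin t]. *)
Lemma touching_speed_neq_0 lambda t :
  0 < lambda * (lambda - 1) -> 1 + lambda * cos t <> 0 -> sin t <> 0 ->
  lambda * (lambda - 1) * sin t / (1 + lambda * cos t) ^ 2
  + 1 * ((1 - cos t) / (3 * sin t)) <> 0.
Proof.
  intros Hl Hd Hs H0.
  assert (H : 3 * (lambda * (lambda - 1)) * sin t ^ 2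
              + (1 - cos t) * (1 + lambda * cos t) ^ 2 = 0).
  { replace 0 with (3 * (1 + lambda * cos t) ^ 2 * sin t * 0) by ring.
    rewrite <- H0; field; tauto. }
  assert (0 < sin t ^ 2) by (apply pow2_gt_0; exact Hs).
  pose proof (COS_bound t).
  assert (0 <= (1 + lambda * cos t) ^ 2) by (apply pow2_ge_0). nra.
Qed.

(** * Generators as tangents *)

Lemma continuous_cos_affine a b t : continuous (fun u => a + b * cos u) t.
Proof.
  apply (ex_derive_continuous (K := R_AbsRing) (V := R_NormedModule)).
  auto_derive; exact I.
Qed.

Lemma locally_open_interval a b t : a < t < b -> locally t (fun u => a < u < b).
Proof.
  intros [Ha Hb].
  apply filter_and; [apply (open_gt a t Ha) | apply (open_lt b t Hb)].
Qed.

Lemma tangent_to_edge_oloid_line eps t :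
  is_sign eps -> oloid_param t -> 0 < 1 + 2 * cos t -> cos t <> 0 -> sin t <> 0 ->
  tangent_to_edge (oloid_line eps t) (ruled eps (edge_ratio t) t).
Proof.
  intros He Ht Hq Hc Hs. exists eps; split; [exact He|].
  pose proof (locally_open_interval _ _ _ (oloid_param_interior t Ht Hq)) as Hi.
  apply (ruled_curve_tangent _ _ eps edge_ratio (fun u => u) t t
           (sin t / (3 * cos t ^ 2)) 1);
    try assumption; try reflexivity.
  - apply edge_ratio_derive, Hc.
  - apply (is_derive_id t).
  - apply edge_speed_neq_0; assumption.
  - apply filter_and.
    { apply filter_imp with (2 := Hi); intros u Hu; unfold oloid_param; lra. }
    apply filter_and; apply open_neq; intros H0; apply Hc; rewrite H0, ?cos_neg;
      apply cos_PI2.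
  - assert (Hn : locally t (fun u => 0 + 1 * cos u <> 0))
      by (apply locally_neq_0; [apply continuous_cos_affine | lra]).
    apply filter_imp with (2 := filter_and _ _ Hi Hn); intros u [Hu Hu'].
    apply edge_curve_ruled; [apply cos_ge_on_oloid_param; unfold oloid_param|]; lra.
Qed.

Lemma tangent_to_touching_curve_oloid_line lambda eps t :
  0 < lambda * (lambda - 1) -> contact_equation lambda t ->
  is_sign eps -> oloid_param t -> 0 < 1 + 2 * cos t -> cos t <> 0 -> sin t <> 0 ->
  tangent_to_touching_curve lambda (oloid_line eps t) (ruled eps (edge_ratio t) t).
Proof.
  intros Hl Hce He Ht Hq Hc Hs. pose proof PI_RGT_0 as Hpi.
  pose proof (contact_denominator _ _ Hce Hq) as Hd.
  pose proof (oloid_param_interior t Ht Hq) as Hi.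
  pose proof (touching_speed_neq_0 _ _ Hl Hd Hs) as Hv.
  pose proof (touching_ratio_derive _ _ Hd) as Hder.
  pose proof (touching_ratio_contact _ _ Hce Hq Hc) as Hr.
  assert (Hn : forall u, - (2 * PI / 3) < u < 2 * PI / 3 -> 1 + cos u <> 0).
  { intros u Hu; assert (0 <= 1 + 2 * cos u);
      [apply cos_ge_on_oloid_param; unfold oloid_param|]; lra. }
  destruct He as [-> | ->].
  - assert (Hnear : locally t (fun u => - (2 * PI / 3) < u < 2 * PI / 3 /\
                                        1 + lambda * cos u <> 0)).
    { apply filter_and; [apply locally_open_interval, Hi|].
      apply locally_neq_0; [apply continuous_cos_affine | exact Hd]. }
    apply (ruled_curve_tangent _ _ 1 (touching_ratio lambda) (fun u => u) t t _ 1
             eq_refl Hder); try assumption.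
    + apply (is_derive_id t).
    + apply filter_imp with (2 := Hnear); intros u [Hu Hu']; left; split; [lra|exact Hu'].
    + apply filter_imp with (2 := Hnear); intros u [Hu Hu'].
      unfold touching_curve; destruct Rle_dec; [|lra].
      rewrite <- kappa_ruled, Rmult_1_l by auto; reflexivity.
  - (* The branch [eps = -1] is the second piece of the touching curve, run
       through by the reflected parameter, which changes the sign of the speed. *)
    set (refl := fun u => 4 * PI / 3 - u).
    assert (Hrr : refl (refl t) = t) by (unfold refl; ring).
    assert (Hnear : locally (refl t) (fun u => 2 * PI / 3 < u < 2 * PI /\
                                        1 + lambda * cos (refl u) <> 0)).
    { apply filter_and; [apply locally_open_interval; unfold refl; lra|].
      apply (locally_neq_0 (fun u => 1 + lambda * cos (refl u))).
      - apply (ex_derive_continuous (K := R_AbsRing) (V := R_NormedModule)).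
        unfold refl; auto_derive; exact I.
      - rewrite Hrr; exact Hd. }
    assert (Hdrefl : is_derive refl (refl t) (-1))
      by (unfold refl; auto_derive; [exact I | ring]).
    apply (ruled_curve_tangent _ _ (-1) (fun u => touching_ratio lambda (refl u)) refl
             (refl t) t
             (-1 * (lambda * (lambda - 1) * sin t / (1 + lambda * cos t) ^ 2)) (-1)
             Hrr); try assumption.
    + apply (is_derive_comp (touching_ratio lambda) refl); [rewrite Hrr|]; assumption.
    + rewrite Hrr; exact Hr.
    + intros H0; apply Hv; lra.
    + apply filter_imp with (2 := Hnear); intros u [Hu Hu']; right; split;
        [lra|exact Hu'].
    + apply filter_imp with (2 := Hnear); intros u [Hu Hu'].
      unfold touching_curve; destruct Rle_dec; [lra|]; cbv zeta.
      rewrite <- kappa_ruled; [|apply Hn; unfold refl; lra | exact Hu'].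
      unfold refl; f_equal; ring.
Qed.

(** * Generators contained in the quadric *)

(** The square on the right expresses tangency: the quadric meets the
    generator twice at the point of contact, [m = touching_ratio lambda t]. *)
Lemma quadric_along_oloid_line lambda eps m t :
  0 < lambda * (lambda - 1) -> is_sign eps -> 0 <= 1 + 2 * cos t ->
  omega1 m t ^ 2 / (1 - lambda)
  + (omega2 m t - lambda + 1 / 2) ^ 2 / (1 - lambda + lambda ^ 2)
  + (eps * omega3 m t) ^ 2 / lambda - 1
  = lambda * (1 + 2 * cos t - lambda * (cos t * (cos t + 2)))
      / ((1 - lambda) * (1 - lambda + lambda ^ 2))
    * (1 - m * (1 + lambda * cos t) / (lambda * (1 + cos t))) ^ 2.
Proof.
  intros Hl He Hq.
  assert (Hl0 : lambda <> 0) by nra.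
  assert (Hl1 : 1 - lambda <> 0) by nra.
  assert (Hl2 : 1 - lambda + lambda ^ 2 <> 0) by nra.
  assert (H1 : 1 + cos t <> 0) by lra.
  assert (Hs : sin t ^ 2 = 1 - cos t ^ 2)
    by (pose proof (sin2_cos2 t) as Hp; unfold Rsqr in Hp; lra).
  replace (omega1 m t ^ 2) with ((1 - m) ^ 2 * (1 - cos t ^ 2))
    by (rewrite <- Hs; unfold omega1; ring).
  replace ((eps * omega3 m t) ^ 2) with (m ^ 2 * (1 + 2 * cos t) / (1 + cos t) ^ 2).
  2: { rewrite <- (pow2_sqrt (1 + 2 * cos t)) by exact Hq; unfold omega3.
       destruct He as [-> | ->]; field; exact H1. }
  unfold omega2; field; tauto.
Qed.

Lemma oloid_line_in_quadric lambda eps t :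
  0 < lambda * (lambda - 1) -> is_sign eps -> 0 <= 1 + 2 * cos t ->
  Included R3 (oloid_line eps t) (quadric lambda) <-> contact_equation lambda t.
Proof.
  intros Hl He Hq. unfold contact_equation; split.
  - intros HI.
    (* At [m = 0] the square is 1, so that the point on the first circle
       already forces the other factor to vanish. *)
    assert (H : quadric lambda (ruled eps 0 t)) by (apply HI; exists 0; reflexivity).
    unfold ruled, quadric in H.
    pose proof (quadric_along_oloid_line lambda eps 0 t Hl He Hq) as Hid.
    rewrite H in Hid.
    assert (Hl0 : lambda <> 0) by nra.
    assert (Hl1 : 1 - lambda <> 0) by nra.
    assert (Hl2 : 1 - lambda + lambda ^ 2 <> 0) by nra.
    apply (Rmult_eq_reg_l lambda); [|exact Hl0].
    apply Rminus_diag_uniq_sym.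
    replace 0 with ((1 - 1) * ((1 - lambda) * (1 - lambda + lambda ^ 2))) by ring.
    rewrite Hid; field; repeat split; try assumption; lra.
  - intros Hce p [m ->]. unfold In, quadric.
    apply Rminus_diag_uniq; rewrite quadric_along_oloid_line, Hce by assumption.
    unfold Rdiv; ring.
Qed.

(** [lambda = (1 + 2 * c) / (c * (c + 2))] is a strictly monotone function
    of [c] on either side of its pole [c = 0], and takes different signs
    there.  After clearing denominators this is the factorization
    below, with a second factor that is positive when [c >= -1/2]. *)
Lemma contact_equation_inj lambda t t' :
  contact_equation lambda t -> contact_equation lambda t' ->
  0 <= 1 + 2 * cos t -> 0 < 1 + 2 * cos t' -> cos t = cos t'.
Proof.
  unfold contact_equation; generalize (cos t) (cos t'); intros c c' H H' Hc Hc'.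
  apply Rminus_diag_uniq.
  assert (Hp : (c - c') * ((2 * c + 1) * (2 * c' + 1) + 3) = 0).
  { replace ((c - c') * ((2 * c + 1) * (2 * c' + 1) + 3)) with
      (2 * ((c * (c + 2)) * (1 + 2 * c') - (c' * (c' + 2)) * (1 + 2 * c))) by ring.
    rewrite <- H, <- H'; ring. }
  apply Rmult_integral in Hp; destruct Hp as [Hp | Hp]; [exact Hp | nra].
Qed.

(** A generator is recovered from its points on the two circles, which are the
    only ones with [z = 0] and with [x = 0]. *)
Lemma oloid_line_inj eps eps' t t' :
  is_sign eps' -> cos t = cos t' -> 0 < 1 + 2 * cos t -> sin t <> 0 -> sin t' <> 0 ->
  Same_set R3 (oloid_line eps t) (oloid_line eps' t') -> sin t = sin t' /\ eps = eps'.
Proof.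
  intros He Hc Hq Hs Hs' [HI _].
  assert (Hq0 : sqrt (1 + 2 * cos t) / (1 + cos t) <> 0)
    by (apply Rgt_not_eq, Rdiv_lt_0_compat; [apply sqrt_lt_R0|]; lra).
  assert (He0 : eps' <> 0) by (destruct He; lra).
  split.
  - assert (H : In R3 (oloid_line eps' t') (ruled eps 0 t))
      by (apply HI; exists 0; reflexivity).
    destruct H as [m H]; unfold ruled, omega1, omega3 in H; injection H; intros Hz _ Hx.
    rewrite <- Hc in Hz.
    assert (Hm : m * (eps' * (sqrt (1 + 2 * cos t) / (1 + cos t))) = 0)
      by (unfold Rdiv in *; lra).
    apply Rmult_integral in Hm; destruct Hm as [-> | Hm]; [lra|].
    apply Rmult_integral in Hm; tauto.
  - assert (H : In R3 (oloid_line eps' t') (ruled eps 1 t))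
      by (apply HI; exists 1; reflexivity).
    destruct H as [m H]; unfold ruled, omega1, omega3 in H; injection H; intros Hz _ Hx.
    assert (Hm : (1 - m) * sin t' = 0) by lra.
    apply Rmult_integral in Hm; destruct Hm as [Hm | Hm]; [|contradiction].
    assert (m = 1) by lra; subst m; rewrite <- Hc in Hz.
    apply (Rmult_eq_reg_r (sqrt (1 + 2 * cos t) / (1 + cos t))); [|exact Hq0].
    unfold Rdiv in *; lra.
Qed.

(** * The closed formulas at the contact parameter *)

(** The last equation determines [cos t]; it selects, through the sign of
    [rho lambda], the root of the contact equation in [(-1/2, 1)]. *)
Definition contact_parameter (lambda t : R) : Prop :=
  oloid_param t /\ contact_equation lambda t /\ 0 < 1 + 2 * cos t /\ cos t <> 0 /\
  sin t < 0 /\ rho lambda = lambda * (1 + cos t) - 1.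

Lemma contact_parameter_exists lambda :
  0 < lambda * (lambda - 1) -> exists t, contact_parameter lambda t.
Proof.
  intros Hl.
  set (c := (1 - lambda + rho lambda) / lambda).
  assert (Hl0 : lambda <> 0) by nra.
  assert (Hr : rho lambda = lambda * (1 + c) - 1) by (unfold c; field; exact Hl0).
  assert (Hpos : 0 < 1 - lambda + lambda ^ 2) by nra.
  assert (Hsq : rho lambda ^ 2 = 1 - lambda + lambda ^ 2 /\ 0 < lambda * rho lambda).
  { pose proof (sqrt_lt_R0 _ Hpos). unfold rho.
    rewrite Rpow_mult_distr, pow2_sqrt by lra.
    destruct (Rlt_dec lambda 0);
      [rewrite sign_eq_m1 by lra | rewrite sign_eq_1 by lra]; split; nra. }
  destruct Hsq as [Hsq Hsgn].
  assert (Hce : lambda * (c * (c + 2)) = 1 + 2 * c).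
  { apply (Rmult_eq_reg_l lambda); [|exact Hl0]. rewrite Hr in Hsq; nra. }
  (* At [c = -1/2] and [c = 1], [lambda * (1 + c) - 1] takes the values
     [lambda / 2 - 1] and [2 * lambda - 1], whose squares lie below and above
     [rho lambda ^ 2]. *)
  assert (Hc : - 1 / 2 < c < 1).
  { clear Hce; clearbody c; split; apply Rnot_le_lt; intros Hle.
    - assert (rho lambda ^ 2 <= (lambda / 2 - 1) ^ 2); [|nra].
      rewrite <- (pow2_abs (rho _)), <- (pow2_abs (_ - 1)); apply pow_incr.
      split; [apply Rabs_pos|]; destruct (Rlt_dec lambda 0).
      + rewrite !Rabs_left1 by nra; nra.
      + rewrite !Rabs_right by nra; nra.
    - assert ((2 * lambda - 1) ^ 2 <= rho lambda ^ 2); [|nra].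
      rewrite <- (pow2_abs (rho _)), <- (pow2_abs (_ - 1)); apply pow_incr.
      split; [apply Rabs_pos|]; destruct (Rlt_dec lambda 0).
      + rewrite !Rabs_left1 by nra; nra.
      + rewrite !Rabs_right by nra; nra. }
  assert (Hc0 : c <> 0) by (intros H0; rewrite H0 in Hce; lra).
  destruct (oloid_param_opp_acos c Hc) as (Hp & Hcos & Hsin).
  exists (- acos c); unfold contact_parameter, contact_equation; rewrite Hcos.
  repeat split; try assumption; try apply Hp; lra.
Qed.

Lemma contact_radicand1 lambda t :
  contact_parameter lambda t ->
  (lambda - 1) * (2 - lambda + 2 * rho lambda) = (lambda * sin t)².
Proof.
  intros (_ & Hce & _ & _ & _ & ->). unfold contact_equation in Hce.
  pose proof (sin2_cos2 t) as Hp. rewrite Rsqr_mult.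
  replace (sin t)² with (1 - cos t * cos t) by (unfold Rsqr in *; lra).
  apply Rminus_diag_uniq.
  transitivity (lambda * (lambda * (cos t * (cos t + 2)) - (1 + 2 * cos t)));
    [unfold Rsqr | rewrite Hce]; ring.
Qed.

Lemma contact_radicand2 lambda t :
  contact_parameter lambda t ->
  sqrt (lambda * (2 - lambda + 2 * rho lambda)) = Rabs lambda * sqrt (1 + 2 * cos t).
Proof.
  intros (_ & _ & Hq & _ & _ & ->).
  rewrite <- sqrt_Rsqr_abs, <- sqrt_mult by (try apply Rle_0_sqr; lra).
  f_equal; unfold Rsqr; ring.
Qed.

Lemma sign_Rabs x : sign x * Rabs x = x.
Proof.
  destruct (Rtotal_order x 0) as [H | [-> | H]].
  - rewrite sign_eq_m1, Rabs_left by exact H; ring.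
  - rewrite Rabs_R0; ring.
  - rewrite sign_eq_1, Rabs_right by lra; ring.
Qed.

Lemma omegat_contact lambda t m :
  0 < lambda * (lambda - 1) -> contact_parameter lambda t ->
  omegat1 m lambda = omega1 m t /\ omegat2 m lambda = omega2 m t /\
  omegat3 m lambda = omega3 m t.
Proof.
  intros Hl Ht. assert (Hl0 : lambda <> 0) by nra.
  unfold omegat1, omegat2, omegat3, omega1, omega2, omega3.
  rewrite (contact_radicand1 lambda t), (contact_radicand2 lambda t) by assumption.
  destruct Ht as (_ & _ & Hq & _ & Hs & Hr); rewrite Hr.
  assert (H1 : 1 + cos t <> 0) by lra.
  assert (Ha : Rabs lambda <> 0) by (apply Rabs_no_R0, Hl0).
  repeat split.
  - rewrite sqrt_Rsqr_abs, Rabs_mult, (Rabs_left (sin t)) by exact Hs; field; exact Ha.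
  - field; repeat split; try assumption; nra.
  - rewrite <- Rmult_assoc, sign_Rabs; field; repeat split; try assumption; nra.
Qed.

Lemma r_contact lambda t :
  0 < lambda * (lambda - 1) -> contact_parameter lambda t ->
  (r1 lambda, r2 lambda, r3 lambda) = ruled 1 (edge_ratio t) t.
Proof.
  intros Hl Ht. assert (Hl0 : lambda <> 0) by nra.
  pose proof Ht as (_ & Hce & Hq & Hc & Hs & Hr).
  pose proof (contact_denominator _ _ Hce Hq) as Hd.
  rewrite <- (touching_ratio_contact lambda) by assumption.
  rewrite <- kappa_ruled, Rmult_1_l by (try assumption; lra).
  unfold r1, r2, r3, kappa1, kappa2, kappa3.
  replace ((lambda - 1) ^ 3 * (2 - lambda + 2 * rho lambda))
    with ((lambda * (lambda - 1) * - sin t)²).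
  2: { transitivity ((lambda - 1) ^ 2 * ((lambda - 1) * (2 - lambda + 2 * rho lambda)));
         [|ring].
       rewrite (contact_radicand1 lambda t) by assumption; unfold Rsqr; ring. }
  rewrite sqrt_Rsqr, (contact_radicand2 lambda t) by (try assumption; nra).
  rewrite <- Rmult_assoc, sign_Rabs, Hr.
  f_equal; [f_equal|]; field; repeat split; try assumption; lra.
Qed.

Lemma oloid_line_cos_sin eps t t' :
  cos t = cos t' -> sin t = sin t' -> Same_set R3 (oloid_line eps t) (oloid_line eps t').
Proof.
  intros Hc Hs; apply Same_set_pointwise; intros m.
  unfold omega1, omega2, omega3; rewrite Hc, Hs; reflexivity.
Qed.

Lemma ruled_opp eps m t :
  ruled eps m (- t) = (- omega1 m t, omega2 m t, eps * omega3 m t).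
Proof.
  unfold ruled, omega1, omega2, omega3; rewrite cos_neg, sin_neg.
  f_equal; f_equal; ring.
Qed.

Lemma G_oloid_lines lambda t :
  0 < lambda * (lambda - 1) -> contact_parameter lambda t ->
  Same_set R3 (oloid_line 1 t) (G1 lambda) /\
  Same_set R3 (oloid_line 1 (- t)) (G2 lambda) /\
  Same_set R3 (oloid_line (-1) (- t)) (G3 lambda) /\
  Same_set R3 (oloid_line (-1) t) (G4 lambda).
Proof.
  intros Hl Ht.
  split; [|split; [|split]];
    [apply (Same_set_pointwise (fun m => ruled 1 m t))
    |apply (Same_set_pointwise (fun m => ruled 1 m (- t)))
    |apply (Same_set_pointwise (fun m => ruled (-1) m (- t)))
    |apply (Same_set_pointwise (fun m => ruled (-1) m t))];
    intros m; destruct (omegat_contact lambda t m Hl Ht) as (-> & -> & ->);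
    rewrite ?ruled_opp; unfold ruled; (apply f_equal2; [apply f_equal2|]); ring.
Qed.

Lemma P_edge_points lambda t :
  0 < lambda * (lambda - 1) -> contact_parameter lambda t ->
  P1 lambda = ruled 1 (edge_ratio t) t /\
  P2 lambda = ruled 1 (edge_ratio (- t)) (- t) /\
  P3 lambda = ruled (-1) (edge_ratio (- t)) (- t) /\
  P4 lambda = ruled (-1) (edge_ratio t) t.
Proof.
  intros Hl Ht. pose proof (r_contact lambda t Hl Ht) as H.
  assert (He : edge_ratio (- t) = edge_ratio t)
    by (unfold edge_ratio; rewrite cos_neg; reflexivity).
  rewrite He, !ruled_opp. injection H; intros H3 H2 H1.
  unfold P1, P2, P3, P4, ruled; rewrite H1, H2, H3.
  repeat split; f_equal; ring.
Qed.

(** * The common generating lines *)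

Lemma cos_eq_sin_eq_or_opp t t' : cos t = cos t' -> sin t = sin t' \/ sin t = - sin t'.
Proof.
  intros Hc. pose proof (sin2_cos2 t) as H; pose proof (sin2_cos2 t') as H'.
  rewrite Hc in H; apply Rsqr_eq; lra.
Qed.

Lemma contact_parameter_opp_or lambda t u :
  contact_parameter lambda t -> u = t \/ u = - t ->
  oloid_param u /\ contact_equation lambda u /\ 0 < 1 + 2 * cos u /\ cos u <> 0 /\
  sin u <> 0.
Proof.
  intros ([Ho1 Ho2] & Hce & Hq & Hc & Hs & _) [-> | ->];
    unfold contact_equation, oloid_param in *; rewrite ?cos_neg, ?sin_neg;
    repeat split; try assumption; lra.
Qed.

Lemma common_generating_line_contact lambda t L :
  0 < lambda * (lambda - 1) -> contact_parameter lambda t ->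
  common_generating_line lambda L <->
  Same_set R3 L (oloid_line 1 t) \/ Same_set R3 L (oloid_line 1 (- t)) \/
  Same_set R3 L (oloid_line (-1) (- t)) \/ Same_set R3 L (oloid_line (-1) t).
Proof.
  intros Hl Ht; split.
  - intros [(eps & u & He & Hu & HL) HI].
    pose proof (cos_ge_on_oloid_param u Hu) as Hqu.
    destruct Ht as (_ & Hce & Hq & _).
    assert (Hceu : contact_equation lambda u).
    { apply (oloid_line_in_quadric lambda eps u Hl He Hqu).
      intros p Hp; apply HI, HL, Hp. }
    pose proof (contact_equation_inj _ _ _ Hceu Hce Hqu Hq) as Hc.
    assert (Hu' : Same_set R3 L (oloid_line eps t) \/ Same_set R3 L (oloid_line eps (- t))).
    { destruct (cos_eq_sin_eq_or_opp u t Hc) as [Hs | Hs]; [left | right];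
        apply (Same_set_trans _ _ _ _ HL), oloid_line_cos_sin;
        rewrite ?cos_neg, ?sin_neg; assumption. }
    destruct He as [-> | ->]; tauto.
  - assert (Hgen : forall eps u, is_sign eps -> u = t \/ u = - t ->
              Same_set R3 L (oloid_line eps u) -> common_generating_line lambda L).
    { intros eps u He Hu HL.
      destruct (contact_parameter_opp_or _ _ _ Ht Hu) as (Ho & Hce & Hq & _).
      split; [exists eps, u; tauto|].
      intros p Hp; apply HL in Hp.
      exact (proj2 (oloid_line_in_quadric lambda eps u Hl He (Rlt_le _ _ Hq)) Hce p Hp). }
    intros [HL | [HL | [HL | HL]]]; apply Hgen in HL; unfold is_sign; auto.
Qed.

Lemma tangents_at_contact lambda t eps u :
  0 < lambda * (lambda - 1) -> contact_parameter lambda t -> is_sign eps ->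
  u = t \/ u = - t ->
  tangent_to_edge (oloid_line eps u) (ruled eps (edge_ratio u) u) /\
  tangent_to_touching_curve lambda (oloid_line eps u) (ruled eps (edge_ratio u) u).
Proof.
  intros Hl Ht He Hu.
  destruct (contact_parameter_opp_or _ _ _ Ht Hu) as (Ho & Hce & Hq & Hc & Hs).
  split;
    [apply tangent_to_edge_oloid_line | apply tangent_to_touching_curve_oloid_line];
    assumption.
Qed.

Theorem theorem5 (lambda : R) (hlambda : ~ (0 <= lambda <= 1)) :
  ((forall L : Ensemble R3,
      common_generating_line lambda L <->
      Same_set R3 L (G1 lambda) \/ Same_set R3 L (G2 lambda) \/
      Same_set R3 L (G3 lambda) \/ Same_set R3 L (G4 lambda)) /\
   ~ Same_set R3 (G1 lambda) (G2 lambda) /\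
   ~ Same_set R3 (G1 lambda) (G3 lambda) /\
   ~ Same_set R3 (G1 lambda) (G4 lambda) /\
   ~ Same_set R3 (G2 lambda) (G3 lambda) /\
   ~ Same_set R3 (G2 lambda) (G4 lambda) /\
   ~ Same_set R3 (G3 lambda) (G4 lambda)) /\
  ((tangent_to_edge (G1 lambda) (P1 lambda) /\
    tangent_to_edge (G2 lambda) (P2 lambda) /\
    tangent_to_edge (G3 lambda) (P3 lambda) /\
    tangent_to_edge (G4 lambda) (P4 lambda)) /\
   (tangent_to_touching_curve lambda (G1 lambda) (P1 lambda) /\
    tangent_to_touching_curve lambda (G2 lambda) (P2 lambda) /\
    tangent_to_touching_curve lambda (G3 lambda) (P3 lambda) /\
    tangent_to_touching_curve lambda (G4 lambda) (P4 lambda))).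
Proof.
  assert (Hl : 0 < lambda * (lambda - 1)).
  { destruct (Rlt_dec lambda 0); [nra|]. assert (1 < lambda) by lra; nra. }
  destruct (contact_parameter_exists lambda Hl) as [t Ht].
  destruct (G_oloid_lines lambda t Hl Ht) as (HG1 & HG2 & HG3 & HG4).
  destruct (P_edge_points lambda t Hl Ht) as (HP1 & HP2 & HP3 & HP4).
  split; [|split].
  - split.
    + intros L. rewrite (common_generating_line_contact lambda t L Hl Ht).
      assert (Heq : forall A B, Same_set R3 A B -> Same_set R3 L A <-> Same_set R3 L B).
      { intros A B HAB; split; intros H; apply (Same_set_trans _ _ _ _ H);
          [|apply Same_set_sym]; exact HAB. }
      rewrite (Heq _ _ HG1), (Heq _ _ HG2), (Heq _ _ HG3), (Heq _ _ HG4); reflexivity.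
    + assert (Hsep : forall eps eps' u u' A B,
        is_sign eps' -> u = t \/ u = - t -> u' = t \/ u' = - t ->
        sin u <> sin u' \/ eps <> eps' ->
        Same_set R3 (oloid_line eps u) A -> Same_set R3 (oloid_line eps' u') B ->
        ~ Same_set R3 A B).
      { intros eps eps' u u' A B He' Hu Hu' Hne HA HB HAB.
        destruct (contact_parameter_opp_or _ _ _ Ht Hu) as (_ & _ & Hq & _ & Hs).
        destruct (contact_parameter_opp_or _ _ _ Ht Hu') as (_ & _ & _ & _ & Hs').
        assert (Hc : cos u = cos u')
          by (destruct Hu, Hu'; subst; rewrite ?cos_neg; reflexivity).
        destruct (oloid_line_inj eps eps' u u' He' Hc Hq Hs Hs'); [|tauto].
        apply (Same_set_trans _ _ _ _ HA), (Same_set_trans _ _ _ _ HAB).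
        apply Same_set_sym, HB. }
      assert (Hs : sin t < 0) by apply Ht.
      repeat apply conj; eapply Hsep; try eassumption; unfold is_sign; auto;
        rewrite ?sin_neg; (left; lra) || (right; lra).
  - rewrite HP1, HP2, HP3, HP4.
    repeat apply conj;
      (eapply tangent_to_edge_Same_set; [eassumption|]);
      apply (tangents_at_contact lambda t); unfold is_sign; auto.
  - rewrite HP1, HP2, HP3, HP4.
    repeat apply conj;
      (eapply tangent_at_Same_set; [eassumption|]);
      apply (tangents_at_contact lambda t); unfold is_sign; auto.
Qed.
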